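(* If $G$ is a $P_4$-sparse minimal polar obstruction, then $G$ is a cograph.
   Context: All graphs are simple and finite. A cograph is a graph with no induced path on four vertices. A graph is $P_4$-sparse if every set of five vertices induces at most one $P_4$ (induced path on four vertices). A graph $G$ is polar if its vertex set has a partition $(A,B)$ (parts may be empty) such that $G[A]$ is a complete multipartite graph (any number of parts) and $G[B]$ is a disjoint union of complete graphs (any number). A minimal polar obstruction is a graph that is not polar but all of whose proper induced subgraphs are polar. *)

(* Defs.v *)
From mathcomp Require Import all_boot.

Set Implicit Arguments.
Unset Strict Implicit.
Unset Printing Implicit Defensive.

Record sgraph := SGraph {
  vertex :> finType;
  adj : rel vertex;
  adj_sym : symmetric adj;
  adj_irrefl : irreflexive adj
}.

Section Induced.
Variables (G : sgraph) (S : {set G}).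

Definition induced_vertex : finType := {x : G | x \in S}.

Definition induced_adj : rel induced_vertex :=
  fun x y => adj (val x) (val y).

Lemma induced_adj_sym : symmetric induced_adj.
Proof. by move=> x y; exact: adj_sym. Qed.

Lemma induced_adj_irrefl : irreflexive induced_adj.
Proof. by move=> x; exact: adj_irrefl. Qed.

Definition induced : sgraph := SGraph induced_adj_sym induced_adj_irrefl.

End Induced.

Definition isomorphic (G H : sgraph) : Prop :=
  exists2 f : G -> H, bijective f & forall x y, adj (f x) (f y) = adj x y.

Definition path_adj n : rel 'I_n :=
  fun i j => (i.+1 == j) || (j.+1 == i).

Lemma path_adj_sym n : symmetric (@path_adj n).
Proof. by move=> i j; exact: orbC. Qed.

Lemma path_adj_irrefl n : irreflexive (@path_adj n).
Proof. by move=> i; rewrite /path_adj /= orbb eqn_leq ltnn. Qed.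

(* [path_graph n] has [n] vertices, hence [n - 1] edges. *)
Definition path_graph n : sgraph :=
  SGraph (@path_adj_sym n) (@path_adj_irrefl n).

Definition induces_P4 (G : sgraph) (S : {set G}) : Prop :=
  isomorphic (induced S) (path_graph 4).

Definition cograph (G : sgraph) : Prop :=
  forall S : {set G}, ~ induces_P4 S.

(* An induced subgraph is determined by its vertex set, so the induced P4's
   are counted by their vertex sets. *)
Definition P4_sparse (G : sgraph) : Prop :=
  forall S : {set G}, #|S| = 5 ->
  forall A B : {set G}, A \subset S -> B \subset S ->
  induces_P4 A -> induces_P4 B -> A = B.

(* In the next two definitions the blocks of [P] are, respectively, the parts
   and the components; [P] is empty when [G] has no vertex. *)
Definition complete_multipartite (G : sgraph) : Prop :=
  exists2 P : {set {set G}}, partition P [set: G] &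
    forall x y : G, adj x y = (pblock P x != pblock P y).

Definition disjoint_union_of_complete (G : sgraph) : Prop :=
  exists2 P : {set {set G}}, partition P [set: G] &
    forall x y : G, adj x y = (x != y) && (pblock P x == pblock P y).

Definition polar (G : sgraph) : Prop :=
  exists A B : {set G},
    [/\ A :|: B = [set: G], [disjoint A & B],
        complete_multipartite (induced A) &
        disjoint_union_of_complete (induced B)].

Definition minimal_polar_obstruction (G : sgraph) : Prop :=
  ~ polar G /\
  forall S : {set G}, S \proper [set: G] -> polar (induced S).

(* Main.v *)
Require Import Defs.
From mathcomp Require Import all_boot.

(* Each P4 [a - b - c - d] of a P4-sparse graph sits in a module consisting of
   a clique [K] containing [b], [c], a stable set [S] containing [a], [d], and a
   set [R] complete to [K] and anticomplete to [S]: start from [K = {b, c}],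
   [S = {a, d}], [R] the vertices seeing exactly [b] and [c], and, as long as
   some vertex [n] outside distinguishes a vertex [r] of [R] from [K] or [S],
   move one of [n], [r] to [K] and the other to [S].
   Let [N] and [Z] be the vertices complete, resp. anticomplete, to the module.
   If [G - a] is polar, either its multipartite side has an edge in the module,
   so that it avoids [Z] and [Z] is a cluster, or its trace on the module can be
   replaced by a split partition of the module, and [G] is polar. Dually, if
   [G - b] is polar, [G] is polar or [N] is complete multipartite. In the
   remaining case a polar partition [(A, B)] of [R] extends to the polar
   partition [(N + K + A, Z + S + B)] of [G]. *)

Set Implicit Arguments.
Unset Strict Implicit.
Unset Printing Implicit Defensive.

(** * Polarity, P4s and sparseness for relations, and complementation *)

Section Relations.
Variable T : finType.
Implicit Types (e : rel T) (A X Y : pred T).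

Definition co e : rel T := fun x y => (x != y) && ~~ e x y.

(** For symmetric irreflexive [e], non-adjacency is then an equivalence on [A] whose classes are the
    parts. *)
Definition multipartite_on e A : Prop :=
  forall x y z, A x -> A y -> A z -> ~~ e x y -> ~~ e y z -> ~~ e x z.

Definition cluster_on e A : Prop := multipartite_on (co e) A.

Definition bipolar e X A : Prop :=
  multipartite_on e (predI X A) /\ cluster_on e (predD X A).

Definition is_P4 e a b c d : bool :=
  [&& e a b, e b c, e c d, ~~ e a c, ~~ e b d & ~~ e a d].

(* The only one-vertex extensions of a P4 with a single induced P4: the new
   vertex sees all, none, or exactly the two midpoints. *)
Definition sparse e : Prop :=
  forall a b c d v, is_P4 e a b c d -> v \notin [:: a; b; c; d] ->
  [/\ e v d = e v a, e v c = e v b & e v a -> e v b].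

Lemma co_sym e : symmetric e -> symmetric (co e).
Proof. by move=> se x y; rewrite /co se eq_sym. Qed.

Lemma co_irrefl e : irreflexive (co e).
Proof. by move=> x; rewrite /co eqxx. Qed.

Lemma coK e : irreflexive e -> co (co e) =2 e.
Proof.
move=> ie x y; rewrite /co; case: (eqVneq x y) => [->|_] /=.
  by rewrite ie.
by rewrite negbK.
Qed.

Lemma eq_multipartite_on e e' A A' : e =2 e' -> A =1 A' ->
  multipartite_on e A -> multipartite_on e' A'.
Proof.
by move=> ee AA mA x y z; rewrite -!AA -!ee; exact: mA.
Qed.

Lemma eq_bipolar e e' X A : e =2 e' -> bipolar e X A -> bipolar e' X A.
Proof.
move=> ee [mA cA]; split; first exact: eq_multipartite_on mA.
by apply: eq_multipartite_on cA => // x y; rewrite /co ee.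
Qed.

Lemma bipolar_co e X A : irreflexive e ->
  bipolar e X A -> bipolar (co e) X (predC A).
Proof.
move=> ie [mA cA]; split.
  by apply: eq_multipartite_on cA => // x /=; rewrite andbC.
apply: eq_multipartite_on mA => [x y|x /=]; first by rewrite coK.
by rewrite negbK andbC.
Qed.

Lemma is_P4_uniq e a b c d : symmetric e -> irreflexive e ->
  is_P4 e a b c d -> uniq [:: a; b; c; d].
Proof.
move=> se ie /and5P[ab bc cd ac /andP[bd ad]]; rewrite /= !inE !negb_or.
case: (eqVneq a b) => [E|_]; first by move: ab; rewrite E ie.
case: (eqVneq b c) => [E|_]; first by move: bc; rewrite E ie.
case: (eqVneq c d) => [E|_]; first by move: cd; rewrite E ie.
case: (eqVneq a c) => [E|_]; first by move: ad; rewrite E cd.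
case: (eqVneq a d) => [E|_]; first by move: ac; rewrite E se cd.
by case: (eqVneq b d) => [E|_]; first by move: ad; rewrite -E ab.
Qed.

(** The P4 is self-complementary; the ends [a], [d] become the midpoints, which explains the new
    order. *)
Lemma is_P4_co e a b c d : symmetric e -> irreflexive e ->
  is_P4 e a b c d -> is_P4 (co e) b d a c.
Proof.
move=> se ie P; have := is_P4_uniq se ie P; rewrite /= !inE !negb_or.
case/and4P=> /and3P[ab ac ad] /andP[bc bd] cd _.
case/and5P: P => Eab Ebc Ecd Eac /andP[Ebd Ead].
rewrite /is_P4 /co Ebd bd eq_sym ad se Ead ac Eac eq_sym ab se Eab.
by rewrite bc Ebc (eq_sym d) cd se Ecd.
Qed.

(** Complementing exchanges ends and midpoints; contraposition restores the direction of the
    implication. *)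
Lemma sparse_co e : symmetric e -> irreflexive e -> sparse e -> sparse (co e).
Proof.
move=> se ie spe a b c d v P.
have {}P : is_P4 e b d a c.
  by have := is_P4_co (co_sym se) (@co_irrefl e) P; rewrite /is_P4 !coK.
move=> vP; have /(spe _ _ _ _ _ P) : v \notin [:: b; d; a; c].
  by move: vP; rewrite !inE !negb_or => /and4P[-> -> -> ->].
move: vP; rewrite !inE !negb_or /co => /and4P[-> -> -> ->] /= [-> -> bd].
by split=> //; apply: contraNN.
Qed.

(** * The module around a P4 and its layouts *)

(** The sets K, S, R, N and Z, in this order. *)
Inductive part := Clique | Stable | Rest | Joined | Apart.

Definition dual p :=
  match p with
  | Clique => Stable | Stable => Clique | Rest => Rest
  | Joined => Apart | Apart => Joined
  end.

Definition is_rest p := if p is Rest then true else false.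
Definition is_joined p := if p is Joined then true else false.
Definition is_apart p := if p is Apart then true else false.
Definition inner p :=
  match p with Clique | Stable | Rest => true | _ => false end.

(* [Some b] prescribes the adjacency [b], [None] leaves it free. With
   [full = true], the union of [Clique], [Stable] and [Rest] is a module. *)
Definition forced full p q : option bool :=
  match p, q with
  | Clique, (Clique | Rest) | Rest, Clique => Some true
  | Stable, (Stable | Rest) | Rest, Stable => Some false
  | Joined, (Clique | Stable) | (Clique | Stable), Joined => Some true
  | Apart, (Clique | Stable) | (Clique | Stable), Apart => Some false
  | Joined, Rest | Rest, Joined => if full then Some true else None
  | Apart, Rest | Rest, Apart => if full then Some false else None
  | _, _ => None
  end.

(** [full = false] is the invariant of the growth, where outside vertices may still distinguish
    [Rest] from the other two inner parts; [full = true] is the final state. *)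
Definition layout full e (t : T -> part) : Prop :=
  forall x y b, x != y -> forced full (t x) (t y) = Some b -> e x y = b.

Definition core e (t : T -> part) a b c d : Prop :=
  is_P4 e a b c d /\
  [/\ t a = Stable, t b = Clique, t c = Clique & t d = Stable].

Lemma forced_dual full p q b :
  forced full (dual p) (dual q) = Some b -> forced full p q = Some (~~ b).
Proof. by case: full; case: p; case: q; case: b. Qed.

Lemma forcedC full p q : forced full p q = forced full q p.
Proof. by case: full; case: p; case: q. Qed.

Lemma layout_co full e t : layout full e t -> layout full (co e) (dual \o t).
Proof.
move=> lt x y b xy /= /forced_dual /(lt _ _ _ xy) E.
by rewrite /co xy E negbK.
Qed.

Lemma core_co e t a b c d : symmetric e -> irreflexive e ->
  core e t a b c d -> core (co e) (dual \o t) b d a c.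
Proof.
move=> se ie [/(is_P4_co se ie) P [ta tb tc td]]; split=> //=.
by rewrite ta tb tc td.
Qed.

(* [a - n - c - r] is a second P4; sparseness relative to it forces every other
   vertex to keep its part, so [n] and [r] can join the split graph. *)
Lemma grow_joined e t a b c d n r : symmetric e -> irreflexive e ->
  sparse e -> layout false e t -> core e t a b c d ->
  t n = Joined -> t r = Rest -> ~~ e n r ->
  let t' v := if v == n then Clique else if v == r then Stable else t v in
  layout false e t' /\ core e t' a b c d.
Proof.
move=> se ie spe lt [P [ta tb tc td]] tn tr nr t'.
have neq x y : t x <> t y -> x != y.
  by move=> E; apply/eqP=> xy; rewrite xy in E.
have an : e a n by apply: lt; [apply: neq|]; rewrite ta tn.
have nc : e n c by apply: lt; [apply: neq|]; rewrite tc tn.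
have cr : e c r by apply: lt; [apply: neq|]; rewrite tc tr.
have ar : e a r = false by apply: lt; [apply: neq|]; rewrite ta tr.
have Q : is_P4 e a n c r.
  by case/and5P: P => _ _ _ ac _; rewrite /is_P4 an nc cr ac nr ar.
have Qn v : t v <> Clique -> t v <> Stable -> v != n -> v != r ->
    [/\ e v r = e v a, e v c = e v n & e v a -> e v n].
  move=> vC vS vn vr; apply: spe Q _.
  by rewrite !inE !negb_or vn vr !neq // ?ta ?tc.
have t'E v : t v = Clique \/ t v = Stable -> t' v = t v.
  rewrite /t'; case: eqP => [->|_]; first by rewrite tn; case.
  by case: eqP => [->|//]; rewrite tr; case.
split; last by split=> //; rewrite !t'E ?ta ?tb ?tc ?td //; auto.
(* A vertex of the old clique sees [n], which was [Joined]; by sparseness any other vertex to be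
   checked treats [n] as it treats [c]. *)
have toC v bb : v != n -> forced false (t' v) Clique = Some bb -> e v n = bb.
  move=> vn; rewrite /t' (negPf vn); case: eqP => // /eqP vr.
  have := Qn v; have := lt v n bb vn; have := lt v c bb.
  by rewrite tn tc; case E: (t v) => //= L1 L2 Q';
  have [//|//|//|//|_ <- _] := Q'; apply: L1 => //; apply: neq; rewrite E tc.
(* Likewise, [a] stands in for [r]. *)
have toS v bb : v != n -> v != r ->
    forced false (t' v) Stable = Some bb -> e v r = bb.
  move=> vn vr; rewrite /t' (negPf vn) (negPf vr).
  have := Qn v; have := lt v r bb vr; have := lt v a bb.
  by rewrite tr ta; case E: (t v) => //= L1 L2 Q';
  have [//|//|//|//|-> _ _] := Q'; apply: L1 => //; apply: neq; rewrite E ta.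
have rn : r != n by apply: neq; rewrite tr tn.
have t'n : t' n = Clique by rewrite /t' eqxx.
have t'r : t' r = Stable by rewrite /t' (negPf rn) eqxx.
move=> x y bb xy.
case: (eqVneq y n) => [Ey|yn]; first by rewrite Ey t'n in xy *; apply: toC.
case: (eqVneq x n) => [Ex|xn].
  by rewrite Ex t'n forcedC se; apply: toC.
case: (eqVneq y r) => [Ey|yr]; first by rewrite Ey t'r in xy *; apply: toS.
case: (eqVneq x r) => [Ex|xr]; first by rewrite Ex t'r forcedC se; apply: toS.
by rewrite /t' (negPf xn) (negPf yn) (negPf xr) (negPf yr); apply: lt.
Qed.

(** Induction on the number of [Rest] vertices, since every growth step takes [r] out of [Rest]. A
    bad pair with an [Apart] vertex is a bad pair with a [Joined] vertex in the complement. *)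
Lemma layout_complete e t a b c d : symmetric e -> irreflexive e ->
  sparse e -> layout false e t -> core e t a b c d ->
  exists2 t', layout true e t' & core e t' a b c d.
Proof.
move=> se ie spe; have [m] := ubnP #|[pred v | is_rest (t v)]|.
elim: m t => // m IH t le_m lt ct.
have decr (t' : T -> part) r : t r = Rest -> ~~ is_rest (t' r) ->
    (forall v, is_rest (t' v) -> is_rest (t v)) ->
    #|[pred v | is_rest (t' v)]| < m.
  move=> tr t'r sub; rewrite -ltnS; apply: leq_trans le_m.
  rewrite ltnS; apply: proper_card.
  apply/properP; split; first by apply/subsetP=> v; exact: sub.
  by exists r; rewrite // inE tr.
case: (pickP [pred p | [&& is_joined (t p.1), is_rest (t p.2) & ~~ e p.1 p.2]]).
  move=> [n r] /= /and3P[].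
  case tn: (t n) => // _; case tr: (t r) => // _ nr.
  have [lt' ct'] := grow_joined se ie spe lt ct tn tr nr.
  apply: IH lt' ct'; apply: decr tr _ _.
    by case: eqP => // _; rewrite eqxx.
  by move=> v; case: ifP => // _; case: ifP.
move=> noJ.
case: (pickP [pred p | [&& is_apart (t p.1), is_rest (t p.2) & e p.1 p.2]]).
  move=> [z r] /= /and3P[].
  case tz: (t z) => // _; case tr: (t r) => // _ zr.
  have zNr : z != r by apply/eqP=> E; rewrite E tr in tz.
  have [] := @grow_joined (co e) (dual \o t) b d a c z r (co_sym se)
    (@co_irrefl e) (sparse_co se ie spe) (layout_co lt) (core_co se ie ct).
  - by rewrite /= tz.
  - by rewrite /= tr.
  - by rewrite /co zNr zr.
  set t' := fun v => _ => lt' ct'.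
  pose t2 := dual \o t'.
  have lt2 : layout false e t2.
    by move=> x y bb xy /(layout_co lt' xy); rewrite coK.
  have ct2 : core e t2 a b c d.
    have [P _] := ct; split=> //.
    by case: ct' => _ [ta tb tc td]; rewrite /t2 /= ta tb tc td.
  apply: IH lt2 ct2; apply: decr tr _ _.
    by rewrite /t2 /t' /=; case: eqP => // _; rewrite eqxx.
  move=> v; rewrite /t2 /t' /=; case: ifP => // _; case: ifP => //= _.
  by case: (t v).
move=> noA; exists t => // x y bb xy.
have := noJ (x, y); have := noJ (y, x); have := noA (x, y); have := noA (y, x).
have := lt x y bb xy; rewrite /= (se y x).
case: (t x); case: (t y) => //= _; case: (e x y) => // _ _ _ _ [] //.
Qed.

Lemma layout_of_P4 e a b c d : symmetric e -> irreflexive e ->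
  sparse e -> is_P4 e a b c d -> exists2 t, layout true e t & core e t a b c d.
Proof.
move=> se ie spe P.
have U := is_P4_uniq se ie P.
(* By sparseness, adjacency to [a] and [b] alone determines the type of a vertex off the P4. *)
pose t v := if v \in [:: a; d] then Stable else if v \in [:: b; c] then Clique
  else if e v a then Joined else if e v b then Rest else Apart.
have ct : core e t a b c d.
  split=> //; move: U; rewrite /t /= !inE !negb_or.
  case/and4P=> /and3P[ab ac ad] /andP[bc bd] cd _.
  rewrite !eqxx !orbT /= (eq_sym b a) (eq_sym c a) (negPf ab) (negPf ac).
  by rewrite (negPf bd) (negPf cd).
apply: layout_complete (ct) => //.
have spec v : [\/ v = a, v = d, v = b | v = c] \/
    [/\ e v d = e v a, e v c = e v b & e v a -> e v b]
    /\ t v = if e v a then Joined else if e v b then Rest else Apart.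
  case vP: (v \in [:: a; b; c; d]); last first.
    right; split; first by apply: spe P _; rewrite vP.
    by move: vP; rewrite /t !inE; do 4!case: eqP => // _.
  left; move: vP; rewrite !inE => /or4P[] /eqP; [by constructor 1|
   by constructor 3|by constructor 4|by constructor 2].
have [_ [ta tb tc td]] := ct.
case/and5P: P => Eab Ebc Ecd Eac /andP[Ebd Ead].
(* Only pairs meeting the P4 need checking: with [full = false] nothing is prescribed between
   vertices off it. *)
have half x y bb : [\/ y = a, y = d, y = b | y = c] -> x != y ->
    forced false (t x) (t y) = Some bb -> e x y = bb.
  move=> Hy xy; case: (spec x) => [Hx|[[Ed Ec Eb] ->]].
    case: Hx => Ex; case: Hy => Ey; move: xy; rewrite Ex Ey ?ta ?tb ?tc ?td //=
      ?eqxx // => _ [<-];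
    by rewrite ?Ebc ?(se c b) ?Ebc ?(negPf Ead) ?(se d a) ?(negPf Ead).
  by case: Hy => ->; rewrite ?ta ?tb ?tc ?td ?Ed ?Ec; move: Eb;
   case: (e x a); case: (e x b) => //= H [] //; have := H isT.
move=> x y bb xy.
case: (spec y) => [Hy|[_ Ty]]; first exact: half.
case: (spec x) => [Hx|[_ Tx]].
  by rewrite se forcedC; apply: half; rewrite // eq_sym.
by rewrite Tx Ty; case: (e x a); case: (e x b); case: (e y a); case: (e y b).
Qed.

(* Collapsing the module onto [m] maps [Y] into [X] and preserves [e] on [Y]. *)
Lemma multipartite_replace e t X Y m : symmetric e -> irreflexive e ->
  layout true e t -> multipartite_on e X -> X m -> inner (t m) ->
  (forall x, Y x -> ~~ inner (t x) -> X x) ->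
  (forall x y, Y x -> Y y -> inner (t x) -> inner (t y) -> ~~ e x y) ->
  multipartite_on e Y.
Proof.
move=> se ie lt mX Xm tm YX sY.
pose g x := if inner (t x) then m else x.
have Xg x : Y x -> X (g x).
  by rewrite /g; case: ifP => // /negbT tx Yx; exact: YX.
have moduleE x z : inner (t x) -> ~~ inner (t z) -> e x z = e m z.
  move=> tx tz; have neq y : inner (t y) -> y != z.
    by move=> ty; apply/eqP=> E; rewrite E (negPf tz) in ty.
  have fE y : inner (t y) -> forced true (t y) (t z) = Some (is_joined (t z)).
    by move: tz; case: (t y); case: (t z).
  by rewrite (lt _ _ _ (neq _ tx) (fE _ tx)) (lt _ _ _ (neq _ tm) (fE _ tm)).
have gE x y : Y x -> Y y -> ~~ e x y = ~~ e (g x) (g y).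
  move=> Yx Yy; rewrite /g; case: ifPn => tx; case: ifPn => ty //.
  - by rewrite ie sY.
  - by rewrite (moduleE x y).
  - by rewrite (se x y) (se x m) (moduleE y x).
move=> x y z Yx Yy Yz; rewrite (gE x y) ?(gE y z) ?(gE x z) //.
by apply: mX; apply: Xg.
Qed.

(** * Polar partitions of vertex-deleted subgraphs *)

(** An [Apart] vertex on the multipartite side would be non-adjacent to both ends of any edge of the
    module on that side; so such an edge forces all [Apart] vertices into the cluster side. *)
Lemma apart_cluster e t a b c d A : symmetric e -> irreflexive e ->
  layout true e t -> core e t a b c d -> bipolar e (predC1 a) A ->
  (exists Y, bipolar e predT Y) \/ cluster_on e (is_apart \o t).
Proof.
move=> se ie lt [P [ta tb tc td]] [mA cA].
have := is_P4_uniq se ie P; rewrite /= !inE !negb_or.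
case/and4P=> /and3P[ab ac ad] /andP[bc bd] cd _.
case/and5P: P => Eab Ebc Ecd Eac /andP[Ebd Ead].
have neq x y : t x <> t y -> x != y.
  by move=> E; apply/eqP=> xy; rewrite xy in E.
case: (pickP [pred p | [&& inner (t p.1), inner (t p.2), A p.1, A p.2,
    p.1 != a, p.2 != a & e p.1 p.2]]).
  move=> [x y] /= /and5P[ix iy Ax Ay /and3P[xa ya xy]]; right.
  have apA z : t z = Apart -> ~~ A z.
    move=> tz; apply/negP=> Az.
    have zNa : z != a by apply: neq; rewrite tz ta.
    have nz w : inner (t w) -> e w z = false.
      move=> iw; apply: lt.
        by apply: neq; move: iw; rewrite tz; case: (t w).
      by move: iw; rewrite tz; case: (t w).
    have := mA x z y; rewrite /= xa ya zNa Ax Ay Az xy nz // se nz //.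
    by move=> /(_ isT isT isT isT isT).
  move=> u v w /=.
  case tu: (t u) => // _; case tv: (t v) => // _; case tw: (t w) => // _.
  by apply: cA => /=; rewrite apA // neq // ta ?tu ?tv ?tw.
move=> noE; left.
have stA x y : inner (t x) -> inner (t y) -> A x -> A y ->
    x != a -> y != a -> ~~ e x y.
  move=> ix iy Ax Ay xa ya; have /= := noE (x, y).
  by rewrite ix iy Ax Ay xa ya /= => ->.
have ba : b != a by rewrite eq_sym.
have ca : c != a by rewrite eq_sym.
have da : d != a by rewrite eq_sym.
(* If [b] and [c] were both in [A], they would form an excluded edge; [k] represents the module on
   the cluster side. *)
have [k [tk kA ka]] : exists k, [/\ t k = Clique, ~~ A k & k != a].
  case Ab: (A b); last by exists b; rewrite Ab.
  exists c; split=> //; apply/negP=> Ac.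
  by have := stA b c; rewrite tb tc Ebc => /(_ isT isT Ab Ac ba ca).
(* The induced path [b - c - d] cannot lie in the cluster side; [m] represents the module on the
   multipartite side. *)
have [m [im Am ma]] : exists m, [/\ inner (t m), A m & m != a].
  case Ab: (A b); first by exists b; rewrite tb.
  case Ac: (A c); first by exists c; rewrite tc.
  case Ad: (A d); first by exists d; rewrite td.
  have := cA b c d; rewrite /= Ab Ac Ad ba ca da /co bc cd bd Ebc Ecd Ebd.
  by move=> /(_ isT isT isT isT isT).
(* [Y] splits the module: stable vertices and [Rest] vertices in [A] form a stable set, the others a
   clique. *)
pose Y v := match t v with Clique => false | Stable => true | _ => A v end.
have Rneq x : t x = Rest -> x != a by move=> tx; apply: neq; rewrite tx ta.
exists Y; split.
  apply: (multipartite_replace se ie lt mA (m := m)) => //=.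
  - by rewrite ma.
  - move=> x; rewrite /Y => Yx ix.
    rewrite neq; first by move: Yx ix; case: (t x).
    by move: ix; rewrite ta; case: (t x).
  - move=> x y; rewrite /Y => Yx Yy ix iy.
    case: (eqVneq x y) => [->|xy]; first by rewrite ie.
    have := lt x y false xy; have := stA x y ix iy.
    have := Rneq x; have := Rneq y; move: Yx Yy ix iy.
    case: (t x) => //; case: (t y) => //= Yx Yy _ _ nx ny H H';
    by [rewrite H'|apply: H; auto].
apply: (multipartite_replace (co_sym se) (@co_irrefl e) (layout_co lt)
  cA (m := k)) => //=.
- by rewrite kA.
- by rewrite tk.
- move=> x; rewrite /Y andbT => Yx ix; rewrite neq ?andbT.
    by move: Yx ix; case: (t x).
  by move: ix; rewrite ta; case: (t x).
- move=> x y; rewrite /Y !andbT => Yx Yy ix iy.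
  rewrite /co; case: eqVneq => //= xy; rewrite negbK.
  have := lt x y true xy.
  move: Yx Yy ix iy; case tx: (t x) => //; case ty: (t y) => //= Yx Yy _ _ H;
    try by rewrite H.
  (* Non-adjacent [Rest] vertices [x], [y] on the cluster side would form an induced path through
     [k]. *)
  have := cA x k y; rewrite /= Yx Yy kA ka !Rneq // /co xy.
  have -> : e x k by apply: lt; [apply: neq|]; rewrite tx tk.
  have -> : e k y by apply: lt; [apply: neq|]; rewrite ty tk.
  by rewrite !andbF /= negbK => /(_ isT isT isT isT isT).
Qed.

(** * Assembling a polar partition of the whole graph *)

Definition extend_side (t : T -> part) A : pred T :=
  fun v =>
    match t v with Clique | Joined => true | Rest => A v | _ => false end.

(** Distinct parts among [Clique], [Rest] and [Joined] are completely joined, so distinct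
    non-adjacent vertices share a part, which is [Rest] or [Joined]. *)
Lemma join_multipartite e t A : symmetric e -> irreflexive e ->
  layout true e t -> multipartite_on e (is_joined \o t) ->
  multipartite_on e (predI (is_rest \o t) A) ->
  multipartite_on e (extend_side t A).
Proof.
move=> se ie lt mJ mR x y z Yx Yy Yz xy yz.
have same u v : extend_side t A u -> extend_side t A v ->
    ~~ e u v -> u = v \/ t u = t v.
  rewrite /extend_side => Yu Yv uv.
  case: (eqVneq u v) => [|nuv]; first by left.
  right; have := lt u v true nuv; rewrite (negPf uv).
  by move: Yu Yv; case: (t u) => //; case: (t v) => //= _ _ /(_ erefl).
case: (same x y Yx Yy xy) => [->//|txy].
case: (same y z Yy Yz yz) => [<-//|tyz].
move: Yx Yy Yz; rewrite /extend_side; case tz: (t z) => //;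
  rewrite txy tyz tz => Ax Ay Az.
- suff -> : x = y by [].
  apply/eqP; apply: contraNT xy => /lt; apply; by rewrite txy tyz tz.
- by apply: (mR x y z); rewrite //= ?txy ?tyz ?tz.
- by apply: (mJ x y z); rewrite //= ?txy ?tyz ?tz.
Qed.

Lemma sparse_polar e a b c d : symmetric e -> irreflexive e -> sparse e ->
  is_P4 e a b c d ->
  (forall X v, ~~ X v -> exists A, bipolar e X A) ->
  exists A, bipolar e predT A.
Proof.
move=> se ie spe P minX.
have [t lt ct] := layout_of_P4 se ie spe P.
have [A1 bA1] : exists A, bipolar e (predC1 a) A.
  by apply: (minX _ a); rewrite /= eqxx.
have [//|cZ] := apart_cluster se ie lt ct bA1.
have [A2 bA2] : exists A, bipolar e (predC1 b) A.
  by apply: (minX _ b); rewrite /= eqxx.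
(* In the complement the P4 reads [b d a c], so deleting [b] plays the role of deleting [a]. *)
have [[Y bY]|cN] := apart_cluster (co_sym se) (@co_irrefl e) (layout_co lt)
  (core_co se ie ct) (bipolar_co ie bA2).
  exists (predC Y); apply: eq_bipolar (bipolar_co (@co_irrefl e) bY).
  exact: coK.
have [A [mA cA]] : exists A, bipolar e (is_rest \o t) A.
  by apply: (minX _ a); case: ct => _ [/= -> _ _ _].
have mN : multipartite_on e (is_joined \o t).
  apply: eq_multipartite_on cN => [x y|x /=]; first by rewrite coK.
  by case: (t x).
have J := join_multipartite se ie lt mN mA.
(* [extend_side] for the dual layout and [predC A] is the complement of [extend_side t A], hence the
   cluster side. *)
have J' := @join_multipartite (co e) (dual \o t) (predC A) (co_sym se)
  (@co_irrefl e) (layout_co lt).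
exists (extend_side t A).
split; first by apply: eq_multipartite_on J.
apply: eq_multipartite_on (J' _ _) => //.
- by move=> x; rewrite /extend_side /= andbT; case: (t x).
- by apply: eq_multipartite_on cZ => // x /=; case: (t x).
- apply: eq_multipartite_on cA => // x /=.
  by rewrite andbC; case: (t x).
Qed.

End Relations.

(** * Passing between graphs and relations *)

Lemma complete_multipartite_trans (G : sgraph) :
  complete_multipartite G -> multipartite_on (@adj G) predT.
Proof.
by move=> [P _ PE] x y z _ _ _; rewrite !PE !negbK => /eqP-> /eqP->.
Qed.

Lemma disjoint_union_of_complete_trans (G : sgraph) :
  disjoint_union_of_complete G -> cluster_on (@adj G) predT.
Proof.
move=> [P _ PE] x y z _ _ _.
have coE u v : ~~ co (@adj G) u v = (pblock P u == pblock P v).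
  by rewrite /co PE; case: (eqVneq u v) => [->|_]; rewrite ?eqxx ?negbK.
by rewrite !coE => /eqP-> /eqP->.
Qed.

Lemma partition_of_equivalence (T : finType) (r : rel T) : equivalence_rel r ->
  exists2 P, partition P [set: T] &
    forall x y, (pblock P x == pblock P y) = r x y.
Proof.
move=> er.
have er' : {in [set: T] & &, equivalence_rel r} by move=> x y z _ _ _.
have PP := equivalence_partitionP er'.
exists (equivalence_partition r [set: T]) => // x y.
have /and3P[/eqP cP tP _] := PP.
by rewrite eq_pblock ?cP ?inE // pblock_equivalence_partition ?inE.
Qed.

Lemma nonadj_equivalence (T : finType) (e : rel T) :
  symmetric e -> irreflexive e -> multipartite_on e predT ->
  equivalence_rel (fun x y => ~~ e x y).
Proof.
move=> se ie mT x y z; rewrite ie; split=> // xy.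
by apply/idP/idP; apply: mT => //; rewrite se.
Qed.

Lemma trans_complete_multipartite (G : sgraph) :
  multipartite_on (@adj G) predT -> complete_multipartite G.
Proof.
move/(nonadj_equivalence (@adj_sym G) (@adj_irrefl G))/partition_of_equivalence.
by case=> P PP PE; exists P => // x y; rewrite PE negbK.
Qed.

Lemma trans_disjoint_union_of_complete (G : sgraph) :
  cluster_on (@adj G) predT -> disjoint_union_of_complete G.
Proof.
move/(nonadj_equivalence (co_sym (@adj_sym G)) (@co_irrefl _ _)).
case/partition_of_equivalence=> P PP PE; exists P => // x y; rewrite PE.
by rewrite /co; case: eqVneq => [->|] /=; rewrite ?adj_irrefl ?negbK.
Qed.

Lemma polar_of_bipolar (G : sgraph) A : bipolar (@adj G) predT A -> polar G.
Proof.
move=> [mA cA]; exists [set x | A x], (~: [set x | A x]); split.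
- exact: setUCr.
- by rewrite -setI_eq0 setICr.
- apply: trans_complete_multipartite => x y z _ _ _; apply: mA;
  by [have := valP x; rewrite inE|have := valP y; rewrite inE|
    have := valP z; rewrite inE].
- apply: trans_disjoint_union_of_complete => x y z _ _ _.
  rewrite /co -!(inj_eq val_inj); apply: cA => /=;
  by [have := valP x; rewrite !inE andbT|have := valP y; rewrite !inE andbT|
    have := valP z; rewrite !inE andbT].
Qed.

Lemma bipolar_of_polar_induced (G : sgraph) (X : {set G}) :
  polar (induced X) -> exists A, bipolar (@adj G) (mem X) A.
Proof.
move=> [A [B [AB dAB /complete_multipartite_trans mA
  /disjoint_union_of_complete_trans cB]]].
pose A' := [set val u | u in A]; exists (mem A').
split.
(* Vertices of [induced A] are wrapped twice, since [A] is a vertex set of [induced X]. *)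
- have lift x : predI (mem X) (mem A') x -> 
      exists u : induced A, val (val u) = x.
    by move=> /andP[_ /imsetP[u uA ->]]; exists (Sub u uA).
  move=> _ _ _ /lift[x <-] /lift[y <-] /lift[z <-].
  exact: (mA x y z).
- have lift x : predD (mem X) (mem A') x -> 
      exists u : induced B, val (val u) = x.
    move=> /andP[xA xX]; pose u : induced X := Sub x xX.
    have uB : u \in B.
      have : u \in A :|: B by rewrite AB inE.
      rewrite inE => /orP[uA|//]; case/negP: xA.
      by apply/imsetP; exists u.
    by exists (Sub u uB).
  move=> _ _ _ /lift[x <-] /lift[y <-] /lift[z <-].
  by rewrite /co !(inj_eq val_inj); apply: (cB x y z).
Qed.

(** * P4s as vertex sets and as sequences *)

Lemma induces_P4_exists (G : sgraph) (S : {set G}) :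
  induces_P4 S -> exists a b c d, is_P4 (@adj G) a b c d.
Proof.
move=> [f [g fK gK] fE].
have gE i j : adj (val (g i)) (val (g j)) = path_adj i j.
  by rewrite -[LHS]/(adj (g i) (g j)) -fE !gK.
exists (val (g (inord 0))), (val (g (inord 1))).
exists (val (g (inord 2))), (val (g (inord 3))).
by rewrite /is_P4 !gE /path_adj !inordK.
Qed.

Lemma is_P4_induces (G : sgraph) (a b c d : G) :
  is_P4 (@adj G) a b c d -> induces_P4 [set a; b; c; d].
Proof.
move=> P; have U := is_P4_uniq (@adj_sym G) (@adj_irrefl G) P.
pose s := [:: a; b; c; d].
have sS (i : 'I_4) : nth a s i \in [set a; b; c; d].
  by have := mem_nth a (ltn_ord i : i < size s); rewrite !inE -!orbA.
pose h (i : path_graph 4) : induced [set a; b; c; d] := Sub (nth a s i) (sS i).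
have hI : injective h.
  move=> i j /(congr1 val) /= /eqP; rewrite nth_uniq //; exact: val_eqP.
(* An injection from four vertices into a set of at most four elements is bijective. *)
have [|g hK gK] := inj_card_bij hI.
  rewrite card_ord card_sig.
  apply: leq_trans (card_size s); apply: subset_leq_card.
  by apply/subsetP=> x; rewrite !inE -!orbA.
exists g; first by exists h.
move=> x y; rewrite -{2}[x]gK -{2}[y]gK.
rewrite -[RHS]/(adj (nth a s (g x)) (nth a s (g y))).
case/and5P: P => Eab Ebc Ecd /negPf Eac /andP[/negPf Ebd /negPf Ead].
by case: (g x) => [[|[|[|[|//]]]] ?]; case: (g y) => [[|[|[|[|//]]]] ?];
  rewrite /= ?adj_irrefl // 1?adj_sym.
Qed.

(** A P4 formed by [v] and three of [a], [b], [c], [d] would be a second one in a five-element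
    set. *)
Lemma P4_sparse_sparse (G : sgraph) : P4_sparse G -> sparse (@adj G).
Proof.
move=> spG a b c d v P vP.
have U := is_P4_uniq (@adj_sym G) (@adj_irrefl G) P.
pose S := [set x in [:: v; a; b; c; d]].
have card_S : #|S| = 5.
  by rewrite cardsE; apply/card_uniqP; rewrite cons_uniq vP.
have noP w x y z : all (mem S) [:: w; x; y; z] -> v \in [:: w; x; y; z] ->
    is_P4 (@adj G) w x y z = false.
  move=> /= /and5P[wS xS yS zS _] vQ; apply/negP=> Q.
  have E : [set w; x; y; z] = [set a; b; c; d].
    apply: (spG S) => //; try exact: is_P4_induces;
    by apply/subsetP=> u; rewrite !inE -!orbA => /or4P[] /eqP ->;
      rewrite ?eqxx ?orbT //; move: wS xS yS zS; rewrite !inE.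
  have : v \in [set w; x; y; z] by move: vQ; rewrite !inE -!orbA.
  by rewrite E; move: vP; rewrite !inE -!orbA => /negP.
have sym := @adj_sym G.
(* These eight sequences, with [v] four times an end and four times a midpoint, exclude every
   adjacency pattern but the three allowed ones. *)
have := noP v a b c; have := noP v b c d.
have := noP v c b a; have := noP v d c b.
have := noP a v c d; have := noP d v b a.
have := noP a v d c; have := noP d v a b.
case/and5P: P => Eab Ebc Ecd /negPf Eac /andP[/negPf Ebd /negPf Ead].
rewrite /is_P4 /= !inE !eqxx !orbT /= (sym a v) (sym d v).
rewrite (sym b a) (sym c a) (sym d a) (sym c b) (sym d b) (sym d c).
rewrite Eab Ebc Ecd Eac Ebd Ead /=.
case: (adj v a); case: (adj v b); case: (adj v c); case: (adj v d) => //=;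
  by do 8![move=> /(_ isT isT) // _].
Qed.

Theorem theorem47 (G : sgraph) (sparseG : P4_sparse G)
  (obstrG : minimal_polar_obstruction G) : cograph G.
Proof.
case: obstrG => notpolar minG S /induces_P4_exists[a [b [c [d P]]]].
apply: notpolar; have [A bA] : exists A, bipolar (@adj G) predT A.
  apply: sparse_polar (P4_sparse_sparse sparseG) P _;
    [exact: adj_sym|exact: adj_irrefl|].
  move=> X v Xv; pose X' := [set x | X x].
  have /minG/bipolar_of_polar_induced[A [mA cA]] : X' \proper [set: G].
    rewrite properT; apply: contraNneq Xv => E.
    by have := in_setT v; rewrite -E inE.
  exists A; split; [apply: eq_multipartite_on mA|apply: eq_multipartite_on cA];
  by move=> // x /=; rewrite inE.
exact: polar_of_bipolar bA.
Qed.
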